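(* Suppose $U$ is a unitary operator acting on a $d$-dimensional bipartite Hilbert space $\mathcal{H}$. Then the minimum number of experimental settings $\mu(U)$ required to verify $U$ satisfies $d\le\mu(U)\le 2d$.
   Context: A verification protocol for a unitary $U$ consists of pure product input test states and, for each output state $U|\psi_j\rangle$, a verification protocol based on nonadaptive local projective measurements; it is ordinary if each output-state verification operator has positive spectral gap (one minus its second largest eigenvalue), and $U$ is verified reliably if only the unitary channel of $U$ passes every test with certainty. One experimental setting means the preparation of a pure product input state together with one nonadaptive local projective measurement on the output state; $\mu(U)$ is the minimum number of experimental settings required to verify $U$ by ordinary protocols. *)

(* Defs.v *)
From HB Require Import structures.
From mathcomp Require Import all_boot all_order all_algebra.
From mathcomp Require Import reals.
From mathcomp.real_closed Require Import complex mxtens.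

Set Implicit Arguments.
Unset Strict Implicit.
Unset Printing Implicit Defensive.

Import Order.TTheory GRing.Theory Num.Theory.
Local Open Scope ring_scope.

(* Prop-valued list membership (for types without decidable equality) *)
Fixpoint seq_In (T : Type) (x : T) (s : seq T) : Prop :=
  if s is y :: s' then y = x \/ seq_In x s' else False.

Section QDefs.
Variable C : numClosedFieldType.

Definition adj m n (A : 'M[C]_(m, n)) : 'M[C]_(n, m) := (map_mx Num.conj A)^T.

Definition unitary n (U : 'M[C]_n) : Prop :=
  U *m adj U = 1%:M /\ adj U *m U = 1%:M.

Definition unit_vec n (v : 'cV[C]_n) : Prop := adj v *m v = 1%:M.

Definition projector n (P : 'M[C]_n) : Prop := adj P = P /\ P *m P = P.

Definition proj_meas n (M : seq 'M[C]_n) : Prop :=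
  (forall P, P \in M -> projector P) /\ \sum_(P <- M) P = 1%:M.

(* A test based on a nonadaptive local projective measurement on a bipartite
   system C^dA (x) C^dB: party A performs the projective measurement tmA,
   party B performs tmB, the test is passed iff the pair of outcomes (a,b)
   satisfies tpass a b; the test is performed with probability tw. *)
Record test (dA dB : nat) := Test {
  tmA : seq 'M[C]_dA;
  tmB : seq 'M[C]_dB;
  tpass : nat -> nat -> bool;
  tw : C }.

Definition pass_op dA dB (t : test dA dB) : 'M[C]_(dA * dB) :=
  \sum_(a < size (tmA t)) \sum_(b < size (tmB t))
     (if tpass t a b then (tmA t)`_a *t (tmB t)`_b else 0).

Definition verif_op dA dB (ts : seq (test dA dB)) : 'M[C]_(dA * dB) :=
  \sum_(t <- ts) tw t *: pass_op t.

Definition second_largest_eig n (Om : 'M[C]_n) (beta : C) : Prop :=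
  exists s : seq C,
    char_poly Om = \prod_(z <- s) ('X - z%:P) /\
    (forall z, z \in s -> z \is Num.real) /\
    beta = (sort (fun x y => y <= x) s)`_1.

Definition spectral_gap_pos n (Om : 'M[C]_n) : Prop :=
  exists beta, second_largest_eig Om beta /\ 0 < 1 - beta.

(* a verification protocol of the pure state phi based on nonadaptive local
   projective measurements: a probability distribution over tests each of
   which the target state passes with certainty *)
Definition state_verif dA dB (phi : 'cV[C]_(dA * dB)) (ts : seq (test dA dB))
  : Prop :=
  (forall t, seq_In t ts ->
      [/\ proj_meas (tmA t), proj_meas (tmB t), 0 < tw t &
          pass_op t *m phi = phi]) /\
  \sum_(t <- ts) tw t = 1.

Definition ordinary_state_verif dA dB (phi : 'cV[C]_(dA * dB))
    (ts : seq (test dA dB)) : Prop :=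
  state_verif phi ts /\ spectral_gap_pos (verif_op ts).

(* one element of a gate-verification protocol: a pure product input state
   inA (x) inB together with a verification protocol of the output state *)
Record gate_item (dA dB : nat) := GateItem {
  inA : 'cV[C]_dA;
  inB : 'cV[C]_dB;
  itests : seq (test dA dB) }.

Definition in_state dA dB (it : gate_item dA dB) : 'cV[C]_(dA * dB) :=
  inA it *t inB it.

Definition kraus n (Ks : seq 'M[C]_n) : Prop :=
  \sum_(K <- Ks) adj K *m K = 1%:M.

Definition apply_channel n (Ks : seq 'M[C]_n) (rho : 'M[C]_n) : 'M[C]_n :=
  \sum_(K <- Ks) K *m rho *m adj K.

Definition passes_all dA dB (prot : seq (gate_item dA dB))
    (Ks : seq 'M[C]_(dA * dB)) : Prop :=
  forall it, seq_In it prot -> forall t, seq_In t (itests it) ->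
    \tr (pass_op t *m apply_channel Ks (in_state it *m adj (in_state it))) = 1.

Definition ordinary_reliable_protocol dA dB (U : 'M[C]_(dA * dB))
    (prot : seq (gate_item dA dB)) : Prop :=
  (forall it, seq_In it prot ->
     [/\ unit_vec (inA it), unit_vec (inB it) &
         ordinary_state_verif (U *m in_state it) (itests it)]) /\
  (forall Ks, kraus Ks -> passes_all prot Ks ->
     forall rho, apply_channel Ks rho = U *m rho *m adj U).

Definition num_settings dA dB (prot : seq (gate_item dA dB)) : nat :=
  size (undup [seq (in_state it, (tmA t, tmB t)) | it <- prot, t <- itests it]).

Definition verifiable_with dA dB (U : 'M[C]_(dA * dB)) (k : nat) : Prop :=
  exists prot, ordinary_reliable_protocol U prot /\ num_settings prot = k.

End QDefs.

(* Main.v *)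
(* Lower bound: if the input states do not span, some v is orthogonal to all of
   them; U composed with the reflection 1 - 2|v><v| acts on the inputs like U
   and therefore passes every test, yet it is a different channel.

   Upper bound: take the d product inputs a_i (x) b_j, where (a_i) and (b_j) are
   bases of unit vectors that are pairwise nonorthogonal. Identify a bipartite
   state phi with its dA x dB matrix of amplitudes. Two tests determine phi up
   to a scalar: correlation in the Schmidt bases restricts a state to
   sum_i x_i u_i (x) v_i, and a second test, in which B projects on a vector
   overlapping all the v_i and A on the resulting conditional state of phi,
   forces the x_i to be proportional to the Schmidt coefficients. The average of
   two projectors with a one-dimensional common range has second eigenvalue
   below 1. If a channel passes everything, each Kraus operator K sends every
   input psi to c(K, psi) U psi; trace preservation and nonorthogonality make
   c(K, psi) independent of psi, and since the inputs span, K = c(K) U. *)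
Require Import Defs.
From HB Require Import structures.
From mathcomp Require Import all_boot all_order all_algebra.
From mathcomp Require Import reals.
From mathcomp.real_closed Require Import complex mxtens.
Import Order.TTheory GRing.Theory Num.Theory.
Local Open Scope ring_scope.

Section Verification.
Variable C : numClosedFieldType.

(** * Adjoints, squared norms and projectors *)

Lemma adjmxE m n (A : 'M[C]_(m, n)) i j : adj A i j = (A j i)^*.
Proof. by rewrite !mxE. Qed.

Lemma adjmxK m n (A : 'M[C]_(m, n)) : adj (adj A) = A.
Proof. by apply/matrixP => i j; rewrite !adjmxE conjCK. Qed.

Lemma adjmxM m n p (A : 'M[C]_(m, n)) (B : 'M[C]_(n, p)) :
  adj (A *m B) = adj B *m adj A.
Proof. by rewrite /adj map_mxM trmx_mul. Qed.

Lemma adjmxD m n (A B : 'M[C]_(m, n)) : adj (A + B) = adj A + adj B.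
Proof. by rewrite /adj map_mxD linearD. Qed.

Lemma adjmxB m n (A B : 'M[C]_(m, n)) : adj (A - B) = adj A - adj B.
Proof. by rewrite /adj map_mxB linearB. Qed.

Lemma adjmxZ m n c (A : 'M[C]_(m, n)) : adj (c *: A) = c^* *: adj A.
Proof. by rewrite /adj map_mxZ linearZ. Qed.

Lemma adjmx0 m n : adj (0 : 'M[C]_(m, n)) = 0.
Proof. by rewrite /adj map_mx0 trmx0. Qed.

Lemma adjmx1 n : adj (1%:M : 'M[C]_n) = 1%:M.
Proof. by rewrite /adj map_mx1 trmx1. Qed.

Lemma adjmx_sum m n I (r : seq I) (F : I -> 'M[C]_(m, n)) :
  adj (\sum_(i <- r) F i) = \sum_(i <- r) adj (F i).
Proof. by apply: (big_morph _ (@adjmxD m n)); exact: adjmx0. Qed.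

Lemma adjmx_trmx m n (A : 'M[C]_(m, n)) : adj A^T = (adj A)^T.
Proof. by apply/matrixP => i j; rewrite !mxE. Qed.

Lemma adjmx_tens m n p q (A : 'M[C]_(m, n)) (B : 'M[C]_(p, q)) :
  adj (A *t B) = adj A *t adj B.
Proof. by rewrite /adj map_mxT trmx_tens. Qed.

Lemma adjmx_delta_mx m n i j : adj (delta_mx i j : 'M[C]_(m, n)) = delta_mx j i.
Proof. by apply/matrixP => k l; rewrite adjmxE !mxE rmorph_nat andbC. Qed.

Lemma mxtrace_adj_mul m n (A : 'M[C]_(m, n)) :
  \tr (adj A *m A) = \sum_i \sum_j `|A i j| ^+ 2.
Proof.
rewrite /mxtrace exchange_big; apply: eq_bigr => j _.
by rewrite mxE; apply: eq_bigr => i _; rewrite adjmxE normCK mulrC.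
Qed.

Lemma mxtrace_adj_mul_ge0 m n (A : 'M[C]_(m, n)) : 0 <= \tr (adj A *m A).
Proof.
by rewrite mxtrace_adj_mul; do 2![apply: sumr_ge0 => ? _]; rewrite exprn_ge0.
Qed.

Lemma mxtrace_adj_mul_eq0 m n (A : 'M[C]_(m, n)) :
  \tr (adj A *m A) = 0 -> A = 0.
Proof.
rewrite mxtrace_adj_mul => A0; apply/matrixP => i j; rewrite mxE.
have ge0 k l : 0 <= `|A k l| ^+ 2 by rewrite exprn_ge0.
have Ai0 := psumr_eq0P (fun k _ => sumr_ge0 _ (fun l _ => ge0 k l)) A0
  (i := i) isT.
have /eqP := psumr_eq0P (fun l _ => ge0 i l) Ai0 (i := j) isT.
by rewrite expf_eq0 normr_eq0 => /eqP.
Qed.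

Lemma projector_compl n (P : 'M[C]_n) : projector P -> projector (1%:M - P).
Proof.
case=> Ph PP; split; first by rewrite adjmxB adjmx1 Ph.
by rewrite mulmxBr !mulmxBl !mulmx1 mul1mx PP subrr subr0.
Qed.

Lemma projector_tens m n (P : 'M[C]_m) (Q : 'M[C]_n) :
  projector P -> projector Q -> projector (P *t Q).
Proof.
by case=> Ph PP [Qh QQ]; split; rewrite ?adjmx_tens ?tensmx_mul ?Ph ?Qh ?PP ?QQ.
Qed.

Lemma mxtrace_projector n p (P : 'M[C]_n) (A : 'M[C]_(n, p)) : projector P ->
  \tr (adj A *m (P *m A)) = \tr (adj (P *m A) *m (P *m A)).
Proof. by case=> Ph PP; rewrite adjmxM Ph !mulmxA -(mulmxA _ P P) PP. Qed.

(** * Spectral decomposition and the spectral gap *)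

Lemma hermitian_spectral n (A : 'M[C]_n) : adj A = A ->
  exists V, exists2 D : 'rV[C]_n, unitary V &
    (forall i, D 0 i \is Num.real) /\ A = adj V *m diag_mx D *m V.
Proof.
move=> Ah.
have Aherm : A \is hermsymmx.
  by apply/is_hermitianmxP; rewrite expr0 scale1r -[LHS]Ah /adj map_trmx.
have /unitarymxP VV := spectral_unitarymx A.
have Vu := spectral_unit A.
have Vinv : invmx (spectralmx A) = adj (spectralmx A).
  by rewrite invmx_unitary ?spectral_unitarymx // /adj map_trmx.
exists (spectralmx A), (spectral_diag A).
  by rewrite /unitary -Vinv mulmxV ?mulVmx.
split.
  by move=> i; move/mxOverP: (hermitian_spectral_diag_real Aherm); apply.
by rewrite -Vinv; apply/orthomx_spectralP/hermitian_normalmx.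
Qed.

(** Links the diagonal form to [second_largest_eig], which is phrased through the roots of the
    characteristic polynomial. *)
Lemma char_poly_unitary n (V : 'M[C]_n) (D : 'rV[C]_n) : unitary V ->
  char_poly (adj V *m diag_mx D *m V) = \prod_i ('X - (D 0 i)%:P).
Proof.
case=> VV VV'.
have -> : char_poly (adj V *m diag_mx D *m V) = char_poly (diag_mx D).
  rewrite /char_poly /char_poly_mx !map_mxM /=.
  set W := map_mx _ V; set W' := map_mx _ (adj V).
  have W1 : W' *m W = 1%:M by rewrite -map_mxM VV' map_mx1.
  have XE : 'X%:M = W' *m 'X%:M *m W by rewrite scalar_mxC -mulmxA W1 mulmx1.
  by rewrite [in LHS]XE -mulmxBl -mulmxBr !det_mulmx mulrAC -det_mulmx W1 det1
    mul1r.
rewrite char_poly_trig ?diag_mx_is_trig //.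
by apply: eq_bigr => i _; rewrite mxE eqxx.
Qed.

(** The deficit [a] is the squared norm of [(1%:M - T) *m v]. Naming it lets the deficits of two
    tests be added. *)
Lemma mxtrace_projector_le n (T : 'M[C]_n) (v : 'cV[C]_n) : projector T ->
  exists2 a, 0 <= a & \tr (adj v *m (T *m v)) = \tr (adj v *m v) - a /\
    (a = 0 -> T *m v = v).
Proof.
move=> Tp; set w := (1%:M - T) *m v.
exists (\tr (adj w *m w)); first exact: mxtrace_adj_mul_ge0.
rewrite -mxtrace_projector; last exact: projector_compl.
split.
  by rewrite mulmxBl mul1mx mulmxBr linearB /= opprB addrCA subrr addr0.
rewrite mxtrace_projector; last exact: projector_compl.
move/mxtrace_adj_mul_eq0 => /eqP.
by rewrite mulmxBl mul1mx subr_eq0 => /eqP.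
Qed.

(** Without a gap, two orthonormal eigenvectors would have eigenvalue at least 1. Both would be
    fixed by [T1] and [T2], hence be multiples of [phi], contradicting their orthogonality. *)
Lemma half_sum_projectors_gap n (T1 T2 : 'M[C]_n) (phi : 'cV[C]_n) :
  (1 < n)%N -> projector T1 -> projector T2 ->
  (forall v : 'cV_n, T1 *m v = v -> T2 *m v = v -> exists c, v = c *: phi) ->
  spectral_gap_pos (2^-1 *: T1 + 2^-1 *: T2).
Proof.
move=> n_gt1 T1p T2p fix12; set Om := _ + _.
have two_real : (2^-1 : C)^* = 2^-1 by rewrite geC0_conj // invr_ge0 ler0n.
have Omh : adj Om = Om.
  by case: T1p T2p => [T1h _] [T2h _]; rewrite adjmxD !adjmxZ two_real T1h T2h.
have [V [D [VV VV'] [Dreal OmE]]] := hermitian_spectral _ _ Omh.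
pose s := [seq D 0 i | i <- enum 'I_n].
pose ge := fun x y : C => y <= x.
have s_real : all (mem Num.real) s.
  by apply/allP => _ /mapP[i _ ->]; apply: Dreal.
have s_perm : perm_eq (sort ge s) s by rewrite perm_sort.
have s_size : size (sort ge s) = n by rewrite size_sort size_map size_enum_ord.
have sort_real k : (k < n)%N -> (sort ge s)`_k \is Num.real.
  move=> kn; apply: (allP s_real); rewrite -(perm_mem s_perm) mem_nth //.
  by rewrite s_size.
exists (sort ge s)`_1; split.
  exists s; split; last by split; [exact/allP | ].
  by rewrite OmE char_poly_unitary ?big_map ?big_enum.
rewrite subr_gt0 real_ltNge ?real1 ?sort_real //; apply/negP => top1.
have top0 : 1 <= (sort ge s)`_0.
  apply: le_trans top1 _.
  (* The order on [C] is only partial; sorting works because the eigenvalues are real. *)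
  have /sortedP/(_ 0%N) : sorted ge (sort ge s).
    apply: (@sort_sorted_in _ (mem Num.real)) => // x y xr yr.
    by rewrite /ge orbC; exact: real_leVge.
  by rewrite s_size; apply.
(* Sorting forgets the indices. Counting is invariant under it and recovers two distinct indices. *)
have : (1 < count (>= 1)%R s)%N.
  rewrite -(permP s_perm); move: s_size top0 top1.
  case: (sort ge s) => [|x [|y t]] /= ns; rewrite -?ns // in n_gt1 *.
  by move=> -> ->.
rewrite count_map (_ : count _ _ = #|[pred i | 1 <= D 0 i]|%R); last first.
  by rewrite enumT cardE /enum_mem size_filter; apply: eq_count.
case/card_gt1P => i [j] [].
rewrite !inE /= => -[Di Dj ij].
pose x k : 'cV[C]_n := adj V *m delta_mx k 0.
have x_dot k l : \tr (adj (x k) *m x l) = (k == l)%:R.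
  rewrite /x adjmxM adjmxK adjmx_delta_mx mulmxA -(mulmxA _ V) VV mulmx1.
  by rewrite mul_delta_mx_cond trace_mx11 mulmxnE mxE !eqxx.
have x_eigen k : Om *m x k = D 0 k *: x k.
  rewrite OmE /x -(mulmxA _ V) (mulmxA V) VV mul1mx -mulmxA mul_diag_mx
    scalemxAr.
  congr (_ *m _); apply/matrixP => a b; rewrite !mxE.
  by case: (eqVneq a k) => [->|]; rewrite ?mulr0.
have x_phi k : 1 <= D 0 k -> exists c, x k = c *: phi.
  move=> Dk.
  have [a a0 [aE aP]] := mxtrace_projector_le _ _ (x k) T1p.
  have [b b0 [bE bP]] := mxtrace_projector_le _ _ (x k) T2p.
  have : \tr (adj (x k) *m (Om *m x k)) = D 0 k.
    by rewrite x_eigen -scalemxAr linearZ /= x_dot eqxx mulr1.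
  rewrite /Om mulmxDl mulmxDr linearD /= -!scalemxAl -!scalemxAr !linearZ /=.
  rewrite aE bE x_dot eqxx => DkE.
  (* The quadratic form of [Om] at [x k] is [1 - (a + b) / 2], which leaves no room for positive
     deficits. *)
  have ab0 : a + b <= 0.
    rewrite -DkE in Dk.
    have {Dk} := ler_wpM2l (ler0n C 2) Dk.
    rewrite mulrDr !mulrA divff ?pnatr_eq0 // !mul1r mulr1 addrACA -opprD.
    by rewrite -[1 + 1]/2%:R lerBrDr gerDl.
  have /andP[/eqP a_0 /eqP b_0] : (a == 0) && (b == 0).
    by rewrite -paddr_eq0 // eq_le ab0 addr_ge0.
  by apply: fix12; [exact: aP | exact: bP].
have [c xc] := x_phi _ Di; have [e xe] := x_phi _ Dj.
have := x_dot i j; rewrite (negPf ij) xc xe.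
rewrite adjmxZ -scalemxAr -scalemxAl !linearZ /= => /eqP.
have nz k a : x k = a *: phi -> a != 0 /\ \tr (adj phi *m phi) != 0.
  move=> xk; have := x_dot k k; rewrite eqxx xk.
  rewrite adjmxZ -scalemxAr -scalemxAl !linearZ /= => aE; apply/andP.
  rewrite -negb_or; apply/negP => /orP[]/eqP a0; move: aE => /eqP;
    by rewrite a0 ?(mul0r, mulr0) eq_sym oner_eq0.
have [c0 phi0] := nz _ _ xc; have [e0 _] := nz _ _ xe.
by rewrite !mulf_eq0 conjC_eq0 (negPf c0) (negPf e0) (negPf phi0).
Qed.

(** * Orthogonal sums and rank-one projectors *)

Lemma projector_trmx n (P : 'M[C]_n) : projector P -> projector P^T.
Proof. by case=> Ph PP; split; rewrite ?adjmx_trmx ?Ph // -trmx_mul PP. Qed.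

Lemma projector_sum n (I : finType) (F : I -> 'M[C]_n) :
  (forall i, projector (F i)) -> (forall i j, i != j -> F i *m F j = 0) ->
  projector (\sum_i F i).
Proof.
move=> Fp F0; split; first by rewrite adjmx_sum; apply: eq_bigr => i _;
  case: (Fp i).
rewrite mulmx_suml; apply: eq_bigr => i _; rewrite mulmx_sumr (bigD1 i) //=.
rewrite (proj2 (Fp i)) big1 ?addr0 // => j ji; apply: F0.
by rewrite eq_sym.
Qed.

(* At [v = 0] the junk value [0^-1 = 0] gives the zero projector. *)
Definition line_proj n (v : 'cV[C]_n) : 'M[C]_n :=
  (\tr (adj v *m v))^-1 *: (v *m adj v).

Lemma line_proj_id n (v : 'cV[C]_n) : line_proj n v *m v = v.
Proof.
have vE : adj v *m v = (\tr (adj v *m v))%:M by rewrite trace_mx11 -mx11_scalar.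
rewrite -scalemxAl -mulmxA vE mul_mx_scalar scalerA.
have [/mxtrace_adj_mul_eq0 v0 | c0] := eqVneq (\tr (adj v *m v)) 0.
  by rewrite v0 scaler0.
by rewrite !mxtrace_scalar mulVf ?scale1r.
Qed.

Lemma line_proj_mul n (v u : 'cV[C]_n) : exists c, line_proj n v *m u = c *: v.
Proof.
exists ((\tr (adj v *m v))^-1 * (adj v *m u) 0 0).
rewrite -scalemxAl -mulmxA [adj v *m u]mx11_scalar mul_mx_scalar scalerA.
by rewrite !mxE eqxx.
Qed.

Lemma line_proj_projector n (v : 'cV[C]_n) : projector (line_proj n v).
Proof.
split.
  by rewrite adjmxZ adjmxM adjmxK geC0_conj // invr_ge0 mxtrace_adj_mul_ge0.
by rewrite {2}/line_proj -scalemxAr mulmxA line_proj_id.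
Qed.

Lemma line_proj_ortho n (u v : 'cV[C]_n) :
  adj u *m v = 0 -> line_proj n u *m line_proj n v = 0.
Proof.
move=> uv; rewrite -scalemxAl -scalemxAr mulmxA -(mulmxA u) uv.
by rewrite mulmx0 mul0mx !scaler0.
Qed.

(** * Local tests on a bipartite state *)

Section Bipartite.
Variables dA dB : nat.

Lemma sum_mxtens (F : 'I_(dA * dB) -> C) :
  \sum_k F k = \sum_i \sum_j F (mxtens_index (i, j)).
Proof.
rewrite pair_big /= (reindex (@mxtens_index dA dB)) /=; last first.
  by exists (@mxtens_unindex dA dB) => k _;
    rewrite (mxtens_indexK, mxtens_unindexK).
by apply: eq_bigr => -[].
Qed.

(** In this form A acts from the left and B, transposed, from the right, and a Schmidt decomposition
    is a singular value decomposition. *)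
Definition amplitude_mx (v : 'cV[C]_(dA * dB)) : 'M[C]_(dA, dB) :=
  \matrix_(i, j) v (mxtens_index (i, j)) 0.

Lemma amplitude_mx_inj : injective amplitude_mx.
Proof.
move=> u v /matrixP uv; apply/colP => k.
by case: (mxtens_indexP k) => i j; have := uv i j; rewrite !mxE.
Qed.

Lemma amplitude_mxZ c v : amplitude_mx (c *: v) = c *: amplitude_mx v.
Proof. by apply/matrixP => i j; rewrite !mxE. Qed.

Lemma amplitude_mx_sum I (r : seq I) (F : I -> 'cV[C]_(dA * dB)) :
  amplitude_mx (\sum_(i <- r) F i) = \sum_(i <- r) amplitude_mx (F i).
Proof.
by apply: (big_morph amplitude_mx) => [u v|]; apply/matrixP => i j; rewrite !mxE.
Qed.

Lemma amplitude_mx_tens (P : 'M[C]_dA) (Q : 'M[C]_dB) (v : 'cV[C]_(dA * dB)) :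
  amplitude_mx ((P *t Q) *m v) = P *m amplitude_mx v *m Q^T.
Proof.
apply/matrixP => i j; rewrite !mxE sum_mxtens exchange_big /=.
apply: eq_bigr => l _; rewrite !mxE mulr_suml; apply: eq_bigr => k _.
by rewrite tensmxE mxE mulrAC.
Qed.

Lemma tensmxDl (A B : 'M[C]_dA) (D : 'M[C]_dB) : (A + B) *t D = A *t D + B *t D.
Proof. by apply/matrixP => i j; rewrite !mxE mulrDl. Qed.

Lemma tensmxDr (A : 'M[C]_dA) (B D : 'M[C]_dB) : A *t (B + D) = A *t B + A *t D.
Proof. by apply/matrixP => i j; rewrite !mxE mulrDr. Qed.

Lemma tensmx11 : (1%:M : 'M[C]_dA) *t (1%:M : 'M[C]_dB) = 1%:M.
Proof.
apply/matrixP => i j; case: (mxtens_indexP i) => a b.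
case: (mxtens_indexP j) => k l; rewrite tensmxE !mxE -natrM mulnb.
by rewrite (can_eq (@mxtens_indexK _ _)) xpair_eqE.
Qed.

(* Only one outcome pair fails: B finds [conj b] and A does not find the state
   [amplitude_mx phi *m b] that [phi] predicts for A in that case. *)
Lemma conditional_test (w : C) (phi : 'cV[C]_(dA * dB)) (b : 'cV[C]_dB) :
  exists t : test C dA dB,
  [/\ proj_meas (tmA t), proj_meas (tmB t), tw t = w &
   [/\ projector (pass_op t), pass_op t *m phi = phi &
   forall v, pass_op t *m v = v ->
     exists c, amplitude_mx v *m b = c *: (amplitude_mx phi *m b)]].
Proof.
set a := amplitude_mx phi *m b.
(* The transpose cancels the one that [amplitude_mx_tens] puts on the factor of B. *)
pose P := line_proj _ a; pose Q := (line_proj _ b)^T.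
have Pp : projector P by exact: line_proj_projector.
have Qp : projector Q by apply/projector_trmx/line_proj_projector.
pose t := Test [:: P; 1%:M - P] [:: Q; 1%:M - Q]
            (fun i j => ~~ ((i == 1) && (j == 0)))%N w.
have tE : pass_op t = 1%:M - (1%:M - P) *t Q.
  apply/eqP; rewrite eq_sym subr_eq eq_sym /pass_op /=.
  rewrite !big_ord_recl !big_ord0 /= !addr0 add0r.
  rewrite -tensmxDr addrCA subrr addr0 -addrA -tensmxDr.
  by rewrite subrK -tensmxDl addrCA subrr addr0 tensmx11.
have fix_t v : (pass_op t *m v == v) =
    ((1%:M - P) *m (amplitude_mx v *m Q^T) == 0).
  rewrite tE mulmxBl mul1mx -subr_eq0 addrAC subrr add0r oppr_eq0.
  rewrite -(inj_eq amplitude_mx_inj) amplitude_mx_tens -mulmxA.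
  by congr (_ == _); apply/matrixP => i j; rewrite !mxE.
exists t; split=> //=; first 2 last.
- split.
  + by rewrite tE; apply/projector_compl/projector_tens/Qp/projector_compl.
  + apply/eqP; rewrite fix_t trmxK -scalemxAr mulmxA -/a -scalemxAr mulmxA.
    by rewrite mulmxBl mul1mx line_proj_id subrr mul0mx scaler0.
  (* Evaluating at [b] places the conditional state of [v] in the range of [P]. If [a = 0], this
     range is zero and so is the conditional state. *)
  + move=> v /eqP; rewrite fix_t trmxK => /eqP /(congr1 (mulmx^~ b)).
    rewrite mul0mx -!mulmxA line_proj_id mulmxBl mul1mx => /eqP.
    by rewrite subr_eq0 => /eqP ->; exact: line_proj_mul.
- split; last by rewrite !big_cons big_nil addr0 addrC subrK.
  by move=> ?; rewrite !inE => /orP[]/eqP-> //; exact: projector_compl.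
- split; last by rewrite !big_cons big_nil addr0 addrC subrK.
  by move=> ?; rewrite !inE => /orP[]/eqP-> //; exact: projector_compl.
Qed.

Lemma projector_unitary_delta n (V : 'M[C]_n) i : unitary V ->
  projector (adj V *m delta_mx i i *m V).
Proof.
case=> VV _; split; first by rewrite !adjmxM adjmxK adjmx_delta_mx mulmxA.
rewrite !mulmxA -(mulmxA _ V) VV mulmx1.
rewrite -(mulmxA _ (delta_mx i i) (delta_mx i i)).
by rewrite mul_delta_mx.
Qed.

Lemma sum_unitary_delta n (V : 'M[C]_n) : unitary V ->
  \sum_i adj V *m delta_mx i i *m V = 1%:M.
Proof.
case=> _ VV; rewrite -mulmx_suml -mulmx_sumr.
have -> : \sum_i delta_mx i i = 1%:M :> 'M[C]_n.
  rewrite -diag_const_mx diag_mx_sum_delta; apply: eq_bigr => i _.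
  by rewrite mxE scale1r.
by rewrite mulmx1.
Qed.

Lemma pass_op_diagonal (s : seq 'M[C]_dA) (r : seq 'M[C]_dB) w :
  (size s <= size r)%N ->
  pass_op (Test s r eq_op w) = \sum_(i < size s) s`_i *t r`_i.
Proof.
move=> sr; apply: eq_bigr => i _ /=.
rewrite (bigD1 (widen_ord sr i)) //= eqxx big1 ?addr0 // => j ji.
by case: eqP => // ij; case/eqP: ji; apply: val_inj.
Qed.

Lemma row_mul_adj_row m n (A : 'M[C]_(m, n)) i j :
  row i A *m adj (row j A) = ((A *m adj A) i j)%:M.
Proof.
apply/matrixP => a b; rewrite !ord1 !mxE mulr1n.
by apply: eq_bigr => k _; rewrite !mxE.
Qed.

(** [V] diagonalizes [Phi *m adj Phi], up to normalization the reduced state of A, so the rows of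
    [W] are orthogonal: they are the Schmidt vectors of B scaled by the Schmidt coefficients. A
    measures in the eigenbasis, B along these rows, and equal outcomes pass. *)
Lemma schmidt_test (w : C) (phi : 'cV[C]_(dA * dB)) :
  exists V, exists2 t : test C dA dB, unitary V &
  let W := V *m amplitude_mx phi in
  [/\ proj_meas (tmA t), proj_meas (tmB t), tw t = w,
      forall i j, i != j -> row i W *m adj (row j W) = 0 &
   [/\ projector (pass_op t), pass_op t *m phi = phi &
   forall v, pass_op t *m v = v ->
     forall i, exists c, row i (V *m amplitude_mx v) = c *: row i W]].
Proof.
set Phi := amplitude_mx phi.
have [|V [D Vu [_ PhiE]]] := hermitian_spectral _ (Phi *m adj Phi).
  by rewrite adjmxM adjmxK.
have [VV VV'] := Vu.
pose W := V *m Phi.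
have WW i j : i != j -> row i W *m adj (row j W) = 0.
  move=> ij; rewrite row_mul_adj_row adjmxM mulmxA -(mulmxA V) PhiE !mulmxA VV.
  by rewrite mul1mx -mulmxA VV mulmx1 mxE (negPf ij) mulr0n raddf0.
pose P i := adj V *m delta_mx i i *m V.
pose Q i := line_proj _ (row i W)^T.
have Pp i : projector (P i) by exact: projector_unitary_delta.
have Qp i : projector (Q i) by exact: line_proj_projector.
have PP i j : i != j -> P i *m P j = 0.
  move=> ij; rewrite /P !mulmxA -(mulmxA _ V) VV mulmx1.
  rewrite -(mulmxA _ (delta_mx i i) (delta_mx j j)) mul_delta_mx_0 //.
  by rewrite mulmx0 mul0mx.
have QQ i j : i != j -> Q i *m Q j = 0.
  move=> ij; apply: line_proj_ortho; rewrite adjmx_trmx -trmx_mul WW ?trmx0 //.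
  by rewrite eq_sym.
(* The last outcome of B only completes the measurement: it matches no outcome
   of A. Zero rows of [W] contribute [Q i = 0]. *)
pose Ps := [seq P i | i <- enum 'I_dA].
pose Qs := [seq Q i | i <- enum 'I_dA].
pose t := Test Ps (rcons Qs (1%:M - \sum_i Q i)) eq_op w.
have sP : size Ps = dA by rewrite size_map size_enum_ord.
have sQ : size Qs = dA by rewrite size_map size_enum_ord.
have tE : pass_op t = \sum_i P i *t Q i.
  rewrite pass_op_diagonal ?size_rcons ?sP ?sQ //.
  apply: eq_bigr => i _; rewrite nth_rcons sQ ltn_ord.
  by rewrite !(nth_map i) -?enumT ?size_enum_ord ?nth_ord_enum.
have QP i : row i W *m (Q i)^T = row i W.
  by apply: trmx_inj; rewrite trmx_mul trmxK line_proj_id.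
(* In the eigenbasis of A the test acts row by row, projecting row [i] on the line of [row i W]. *)
have tP v : amplitude_mx (pass_op t *m v) =
    adj V *m \sum_i delta_mx i 0 *m (row i (V *m amplitude_mx v) *m (Q i)^T).
  rewrite tE mulmx_suml amplitude_mx_sum mulmx_sumr; apply: eq_bigr => i _.
  by rewrite amplitude_mx_tens rowE !mulmxA -(mulmxA (adj V)) mul_delta_mx.
have row_sum (F : 'I_dA -> 'rV[C]_dB) i :
    row i (\sum_j delta_mx j (0 : 'I_1) *m F j) = F i.
  rewrite raddf_sum (bigD1 i) //= big1 => [|j ji].
    rewrite addr0 rowE mulmxA mul_delta_mx [delta_mx 0 0]mx11_scalar.
    by rewrite mxE !eqxx mul1mx.
  by rewrite rowE mulmxA mul_delta_mx_0 ?mul0mx // eq_sym.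
exists V, t => //; split=> //.
- split; first by move=> _ /mapP[i _ ->]; exact: Pp.
  by rewrite big_map big_enum /=; exact: sum_unitary_delta.
- split.
    move=> X; rewrite mem_rcons inE => /orP[/eqP->|/mapP[i _ ->]]; last first.
      exact: Qp.
    exact/projector_compl/projector_sum.
  by rewrite /= -cats1 big_cat big_seq1 big_map big_enum /= addrC subrK.
split.
- rewrite tE; apply: projector_sum => [i|i j ij]; first exact: projector_tens.
  by rewrite tensmx_mul PP // tens0mx.
- apply: amplitude_mx_inj; rewrite tP -[RHS]mul1mx -VV' -mulmxA.
  by congr (_ *m _); apply/row_matrixP => i; rewrite row_sum QP.
- move=> v tv i; have := congr1 (fun u => row i (V *m amplitude_mx u)) tv.
  rewrite tP mulmxA VV mul1mx row_sum => <-.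
  have [c Qc] := line_proj_mul _ (row i W)^T (row i (V *m amplitude_mx v))^T.
  by exists c; apply: trmx_inj; rewrite trmx_mul trmxK Qc linearZ.
Qed.

(** The Schmidt test leaves one free scalar per nonzero row of [W]; the conditional test makes these
    scalars agree. *)
Lemma exists_two_tests (phi : 'cV[C]_(dA * dB)) :
  exists t1 t2 : test C dA dB,
  [/\ forall t, seq_In t [:: t1; t2] ->
       [/\ proj_meas (tmA t), proj_meas (tmB t), tw t = 2^-1,
           projector (pass_op t) & pass_op t *m phi = phi] &
      forall v, pass_op t1 *m v = v -> pass_op t2 *m v = v ->
        exists c, v = c *: phi].
Proof.
have [V [t1 [VV VV'] [t1A t1B t1w WW [t1p t1phi t1v]]]] :=
  schmidt_test 2^-1 phi.
set W := V *m amplitude_mx phi in WW t1v.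
(* [b] overlaps every nonzero Schmidt vector of B, so one scalar must serve all
   rows of [W]. *)
pose b := \sum_j adj (row j W).
have [t2 [t2A t2B t2w [t2p t2phi t2v]]] := conditional_test 2^-1 phi b.
have Wb i : row i W *m b = row i W *m adj (row i W).
  rewrite mulmx_sumr (bigD1 i) //= big1 ?addr0 // => j ji.
  by rewrite WW // eq_sym.
exists t1, t2; split; first by move=> t /= [<-|[<-|[]]].
move=> v v1 v2; have [c Xb] := t2v v v2; exists c.
apply: amplitude_mx_inj; rewrite amplitude_mxZ.
rewrite -[LHS]mul1mx -[amplitude_mx phi]mul1mx -VV' -!mulmxA scalemxAr.
congr (_ *m _); apply/row_matrixP => i; rewrite -/W linearZ /=.
have [ci rowi] := t1v v v1 i; rewrite rowi.
have : ci *: (row i W *m b) = c *: (row i W *m b).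
  rewrite scalemxAl -rowi -!row_mul -mulmxA Xb -scalemxAr.
  by rewrite linearZ /= mulmxA.
(* A zero row does not determine [ci], but then both sides vanish. Otherwise [row i W *m b] is a
   nonzero squared norm and cancels. *)
have [-> | W0] := eqVneq (row i W) 0; first by rewrite !scaler0.
move/eqP; rewrite Wb -subr_eq0 -scalerBl scaler_eq0 subr_eq0.
case/orP => [/eqP-> //|/eqP WW0]; case/eqP: W0.
apply: (can_inj (@adjmxK _ _)); rewrite adjmx0; apply: mxtrace_adj_mul_eq0.
by rewrite adjmxK WW0 mxtrace0.
Qed.

(** The last two clauses serve the channel argument, where they are applied to unnormalized Kraus
    outputs. *)
Lemma state_verifiable (phi : 'cV[C]_(dA * dB)) : (1 < dA * dB)%N ->
  exists ts : seq (test C dA dB),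
  [/\ ordinary_state_verif phi ts, size ts = 2%N,
      forall t, seq_In t ts -> projector (pass_op t) &
      forall v, (forall t, seq_In t ts -> pass_op t *m v = v) ->
        exists c, v = c *: phi].
Proof.
move=> d_gt1; have [t1 [t2 [tP fix12]]] := exists_two_tests phi.
have [_ _ w1 p1 _] := tP t1 (or_introl erefl).
have [_ _ w2 p2 _] := tP t2 (or_intror (or_introl erefl)).
exists [:: t1; t2]; split=> //.
- split.
    split; last by rewrite !big_cons big_nil addr0 w1 w2 [RHS]splitr div1r.
    by move=> t /tP[? ? -> _ ?]; rewrite invr_gt0 ltr0n.
  rewrite /verif_op !big_cons big_nil addr0 w1 w2.
  exact: (half_sum_projectors_gap _ _ _ phi).
- by move=> t /tP[].
by move=> v vP; apply: fix12; apply: vP; [left | right; left].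
Qed.

End Bipartite.

(** * Channels in Kraus form *)

(** The stacked Kraus operators form a Stinespring isometry. *)
Lemma kraus_dot n (Ks : seq 'M[C]_n) (u v : 'cV[C]_n) : kraus Ks ->
  \sum_(K <- Ks) \tr (adj (K *m u) *m (K *m v)) = \tr (adj u *m v).
Proof.
move=> KsP; rewrite -raddf_sum /=; congr (\tr _).
transitivity (adj u *m (\sum_(K <- Ks) adj K *m K) *m v).
  rewrite mulmx_sumr mulmx_suml; apply: eq_bigr => K _.
  by rewrite adjmxM !mulmxA.
by rewrite KsP mulmx1.
Qed.

(** The failure probability is the sum of the squared norms of [(1%:M - T) *m (K *m psi)]; when it
    is zero, every term is. *)
Lemma passed_output n (T : 'M[C]_n) (Ks : seq 'M[C]_n) (psi : 'cV[C]_n) :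
  projector T -> kraus Ks -> unit_vec psi ->
  \tr (T *m apply_channel Ks (psi *m adj psi)) = 1 ->
  forall K, K \in Ks -> T *m (K *m psi) = K *m psi.
Proof.
move=> Tp KsP psi1 pass K KKs; have Tcp := projector_compl _ _ Tp.
have trE (S : 'M[C]_n) : \tr (S *m apply_channel Ks (psi *m adj psi)) =
    \sum_(L <- Ks) \tr (adj (L *m psi) *m (S *m (L *m psi))).
  rewrite mulmx_sumr raddf_sum; apply: eq_bigr => L _ /=.
  by rewrite [RHS]mxtrace_mulC adjmxM !mulmxA.
have : \tr ((1%:M - T) *m apply_channel Ks (psi *m adj psi)) = 0.
  rewrite mulmxBl linearB /= pass trE.
  under eq_bigr do rewrite mul1mx.
  by rewrite kraus_dot // psi1 mxtrace1 subrr.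
rewrite trE.
under eq_bigr do rewrite mxtrace_projector //.
move/eqP; rewrite psumr_eq0 => [|L _]; last exact: mxtrace_adj_mul_ge0.
move/allP => /(_ K KKs) /eqP /mxtrace_adj_mul_eq0 /eqP.
by rewrite mulmxBl mul1mx subr_eq0 => /eqP.
Qed.

(** Nonzero overlaps tie the phases of different inputs together. They exclude channels such as
    dephasing, which preserves every state of an orthonormal basis without being the identity. *)
Lemma channel_determined n (U : 'M[C]_n) (Ks : seq 'M[C]_n) (I : Type)
    (psi : I -> 'cV[C]_n) (i0 : I) :
  unitary U -> kraus Ks -> (forall i, unit_vec (psi i)) ->
  (forall i j, adj (psi i) *m psi j != 0) ->
  (forall A : 'M[C]_n, (forall i, A *m psi i = 0) -> A = 0) ->
  (forall K, K \in Ks -> forall i, exists c, K *m psi i = c *: (U *m psi i)) ->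
  forall rho, apply_channel Ks rho = U *m rho *m adj U.
Proof.
move=> [UU UU'] KsP psi1 psi_nz psi_span KsU rho.
pose c (K : 'M[C]_n) i := \tr (adj (U *m psi i) *m (K *m psi i)).
have Udot i j : adj (U *m psi i) *m (U *m psi j) = adj (psi i) *m psi j.
  by rewrite adjmxM mulmxA -(mulmxA _ _ U) UU' mulmx1.
have cP K i : K \in Ks -> K *m psi i = c K i *: (U *m psi i).
  move=> KKs; have [e Ke] := KsU K KKs i.
  by rewrite /c Ke -scalemxAr linearZ /= Udot psi1 mxtrace1 mulr1.
(* Kraus completeness preserves the nonzero overlaps of the inputs, so the
   unit vectors [(c K i)_K] have pairwise inner product 1 and all coincide. *)
have gram i j : \sum_(K <- Ks) (c K i)^* * c K j = 1.
  have nz : \tr (adj (psi i) *m psi j) != 0.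
    apply: contraNneq (psi_nz i j); rewrite trace_mx11 => d0.
    by rewrite [_ *m _]mx11_scalar d0 raddf0.
  apply: (mulIf nz); rewrite mul1r -[RHS](kraus_dot _ _ _ _ KsP) mulr_suml.
  apply: eq_big_seq => K KKs; rewrite (cP K i KKs) (cP K j KKs).
  rewrite adjmxZ -scalemxAr -scalemxAl.
  by rewrite !linearZ /= Udot mulrA [X in X * _]mulrC.
have c_const K i : K \in Ks -> c K i = c K i0.
  move=> KKs; apply/eqP; rewrite -subr_eq0 -normr_eq0 -sqrf_eq0.
  (* The squares expand into four Gram entries, summing to [1 - 1 - (1 - 1)]. *)
  have : \sum_(L <- Ks) `|c L i - c L i0| ^+ 2 = 0.
    transitivity (\sum_(L <- Ks) ((c L i)^* * c L i - (c L i)^* * c L i0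
                 - ((c L i0)^* * c L i - (c L i0)^* * c L i0))).
      apply: eq_bigr => L _; rewrite normCK mulrC rmorphB /=.
      by rewrite mulrBl !mulrBr.
    by rewrite !sumrB !gram !subrr.
  move/eqP; rewrite psumr_eq0 => [|L _]; last by rewrite exprn_ge0.
  by move/allP/(_ K KKs).
have KE K : K \in Ks -> K = c K i0 *: U.
  move=> KKs; apply/eqP; rewrite -subr_eq0; apply/eqP/psi_span => i.
  by rewrite mulmxBl (cP K i KKs) c_const // -scalemxAl subrr.
transitivity (\sum_(K <- Ks) ((c K i0)^* * c K i0) *: (U *m rho *m adj U)).
  apply: eq_big_seq => K KKs; rewrite {1 2}(KE K KKs) adjmxZ -!scalemxAl.
  by rewrite -scalemxAr scalerA mulrC.
by rewrite -scaler_suml gram scale1r.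
Qed.

(** * Nonorthogonal bases and orthogonal complements *)

(** Every standard basis vector except [e 0] is tilted towards [e 0], which makes all overlaps
    positive while keeping a basis. *)
Lemma connected_unit_basis n : (0 < n)%N -> exists a : 'I_n -> 'cV[C]_n,
  [/\ forall i, unit_vec (a i), forall i j, adj (a i) *m a j != 0 &
      exists M : 'M[C]_n, forall k, delta_mx k 0 = \sum_i M k i *: a i].
Proof.
case: n => // n _; pose e (i : 'I_n.+1) : 'cV[C]_n.+1 := delta_mx i 0.
have e_dot i j : adj (e i) *m e j = (i == j)%:R%:M.
  rewrite /e adjmx_delta_mx mul_delta_mx_cond [delta_mx 0 0]mx11_scalar.
  by rewrite mxE !eqxx; case: eqP => _; rewrite ?mulr1n ?mulr0n ?raddf0.
(* [3^2 + 4^2 = 5^2]: unit vectors without square roots. *)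
pose x : C := 3%:R / 5%:R; pose y : C := 4%:R / 5%:R.
pose a i := if i == 0 then e 0 else x *: e 0 + y *: e i.
have x_real : x^* = x by rewrite geC0_conj // divr_ge0 ?ler0n.
have y_real : y^* = y by rewrite geC0_conj // divr_ge0 ?ler0n.
have x0 : x != 0 by rewrite mulf_neq0 ?invr_eq0 ?pnatr_eq0.
have y0 : y != 0 by rewrite mulf_neq0 ?invr_eq0 ?pnatr_eq0.
have xy : x * x + y * y = 1.
  by rewrite !mulf_div -mulrDl -!natrM -natrD divff ?pnatr_eq0.
have a_dot i j : adj (a i) *m a j =
    (if i == 0 then if j == 0 then 1 else x
     else if j == 0 then x else x * x + y * y * (i == j)%:R)%:M.
  rewrite /a; case: (eqVneq i 0) => [_ | i0]; case: (eqVneq j 0) => [_ | j0].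
  - by rewrite e_dot eqxx.
  - by rewrite mulmxDr -!scalemxAr !e_dot eqxx eq_sym (negPf j0)
      !scale_scalar_mx mulr1 mulr0 raddf0 addr0.
  - by rewrite adjmxD !adjmxZ x_real mulmxDl -!scalemxAl !e_dot eqxx (negPf i0)
      !scale_scalar_mx mulr1 mulr0 raddf0 addr0.
  rewrite adjmxD !adjmxZ x_real y_real mulmxDl !mulmxDr -!scalemxAl -!scalemxAr.
  rewrite !e_dot eqxx (eq_sym 0) (negPf i0) (negPf j0) !scale_scalar_mx.
  by rewrite !mulr0 mulr1 raddf0 addr0 add0r [in RHS]raddfD /= (mulrA y y).
exists a; split.
- move=> i; rewrite /unit_vec a_dot eqxx mulr1 xy.
  by case: (i == 0).
- move=> i j; rewrite a_dot; apply/eqP => /matrixP/(_ 0 0)/eqP.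
  rewrite !mxE mulr1n; case: (i == 0); case: (j == 0);
    rewrite ?oner_eq0 ?(negPf x0) //.
  case: (i == j); rewrite ?mulr1 ?xy ?oner_eq0 //.
  by rewrite mulr0 addr0 mulf_eq0 (negPf x0).
(* Inverse change of basis: for [k != 0], [e k = y^-1 *: (a k - x *: a 0)]. *)
exists (\matrix_(k, i) if k == 0 then (i == 0)%:R else
   y^-1 * ((i == k)%:R - x * (i == 0)%:R)); move=> k.
have a0 : a 0 = e 0 by rewrite /a eqxx.
have [-> | k0] := eqVneq k 0.
  rewrite (bigD1 0) //= big1 => [|i i0];
    rewrite mxE eqxx ?(negPf i0) ?scale0r //.
  by rewrite scale1r addr0 a0.
rewrite (bigD1 0) //= (bigD1 k) //= big1 => [|i /andP[i0 ik]];
  rewrite mxE (negPf k0).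
  rewrite mxE (negPf k0) !eqxx eq_sym (negPf k0) a0 /a (negPf k0).
  rewrite sub0r !mulr1 mulr0 subr0 mulr1 addr0 scalerDr !scalerA mulVf //.
  rewrite scale1r.
  by rewrite mulrN addrA -scalerDl addNr scale0r add0r.
by rewrite (negPf i0) (negPf ik) mulr0 subr0 mulr0 scale0r.
Qed.

(** A matrix whose columns are the vectors of [S] has fewer columns than rows, hence a nonzero left
    kernel. *)
Lemma orthogonal_vector n (S : seq 'cV[C]_n) : (size S < n)%N ->
  exists2 v : 'cV[C]_n, v != 0 & forall s, s \in S -> adj v *m s = 0.
Proof.
move=> Sn; pose M : 'M[C]_(n, size S) := \matrix_(i, j) S`_j i 0.
have /rowV0Pn[u /sub_kermxP uM u0] : kermx M != 0.
  rewrite -mxrank_eq0 mxrank_ker -lt0n subn_gt0.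
  exact: leq_ltn_trans (rank_leq_col _) Sn.
exists (adj u) => [|s /(nthP 0)[j jS <-]].
  by apply: contra_neq u0 => u0; rewrite -[u]adjmxK u0 adjmx0.
have uS : (u *m M) 0 (Ordinal jS) = (u *m S`_j) 0 0.
  by rewrite !mxE; apply: eq_bigr => k _; rewrite mxE.
by rewrite adjmxK [LHS]mx11_scalar -uS uM mxE raddf0.
Qed.

(** * Lists of tests and settings *)

Lemma seq_In_map (A B : Type) (f : A -> B) (s : seq A) y :
  seq_In y (map f s) <-> exists2 x, seq_In x s & y = f x.
Proof.
elim: s => [|x s IH] /=; first by split=> // -[].
split=> [[<-|/IH[z zs yz]]|[z [->|zs] yz]].
- by exists x; [left|].
- by exists z; [right|].
- by left.
- by right; apply/IH; exists z.
Qed.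

Lemma seq_In_mem (T : eqType) (x : T) s : seq_In x s <-> x \in s.
Proof.
elim: s => //= y s IH; rewrite inE; split.
  by case=> [->|/IH ->]; rewrite ?eqxx ?orbT.
by case/orP => [/eqP->|/IH]; [left | right].
Qed.

Section Bipartite.
Variables dA dB : nat.

Lemma settings_cons (it : gate_item C dA dB) prot :
  [seq (in_state it, (tmA t, tmB t)) | it <- it :: prot, t <- itests it] =
  [seq (in_state it, (tmA t, tmB t)) | t <- itests it] ++
  [seq (in_state it, (tmA t, tmB t)) | it <- prot, t <- itests it].
Proof. by []. Qed.

Lemma size_settings k (prot : seq (gate_item C dA dB)) :
  (forall it, seq_In it prot -> size (itests it) = k) ->
  size [seq (in_state it, (tmA t, tmB t)) | it <- prot, t <- itests it] =
    (size prot * k)%N.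
Proof.
elim: prot => [//|it prot IH] ks; rewrite settings_cons size_cat size_map.
by rewrite ks ?IH ?mulSn //=; [move=> j jp; apply: ks; right | left].
Qed.

(** An input state enters the list of settings only through its tests, so each item must have at
    least one. *)
Lemma in_state_setting (prot : seq (gate_item C dA dB)) it :
  (forall it, seq_In it prot -> (0 < size (itests it))%N) -> seq_In it prot ->
  in_state it \in
    unzip1 [seq (in_state it, (tmA t, tmB t)) | it <- prot, t <- itests it].
Proof.
elim: prot => [//|it' prot IH] pos.
rewrite settings_cons /unzip1 map_cat mem_cat.
case=> [<-|itp]; apply/orP; last first.
  by right; apply: IH => // j jp; apply: pos; right.
left; have := pos it' (or_introl erefl); case: (itests it') => //= t ts _.
by rewrite inE eqxx.
Qed.

Lemma unit_vec_tens (a : 'cV[C]_dA) (b : 'cV[C]_dB) :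
  unit_vec a -> unit_vec b -> unit_vec (a *t b : 'cV_(dA * dB)).
Proof.
move=> a1 b1; have := tensmx_mul (adj a) (adj b) a b.
by rewrite a1 b1 -adjmx_tens tensmx11.
Qed.

(** * The lower bound *)

Lemma settings_lower_bound (U : 'M[C]_(dA * dB)) k : (1 < dA * dB)%N ->
  unitary U -> verifiable_with U k -> (dA * dB <= k)%N.
Proof.
move=> d_gt1 [UU UU'] [prot [[protP reliable] <-]]; rewrite leqNgt; apply/negP.
rewrite /num_settings; set settings := (X in undup X) => small.
(* The weights of the tests sum to 1, which an empty sum cannot. *)
have nonempty it : seq_In it prot -> (0 < size (itests it))%N.
  case/protP => _ _ [[_ w1] _]; move: w1; case: (itests it) => //.
  by rewrite big_nil => /eqP; rewrite eq_sym oner_eq0.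
have [|v v0 v_orth] := @orthogonal_vector _ (unzip1 (undup settings)).
  by rewrite size_map.
have v_in it : seq_In it prot -> adj v *m in_state it = 0.
  move=> itp; apply: v_orth.
  have /mapP[x xs ->] := in_state_setting _ _ nonempty itp.
  by apply: map_f; rewrite mem_undup.
(* On [v] alone the reflection is a mere phase, invisible to the channel. The coherence [v *m adj w]
   with an orthogonal [w] changes sign and separates the two channels. *)
have [|w w0 w_orth] := @orthogonal_vector _ [:: v]; first exact: d_gt1.
have {w_orth}wv : adj w *m v = 0 by apply: w_orth; rewrite inE.
have vw : adj v *m w = 0 by rewrite -[RHS]adjmx0 -wv adjmxM adjmxK.
pose P := line_proj _ v; have [Ph PP] : projector P := line_proj_projector _ v.
(* The reflection [H] fixes all input states, so [U *m H] passes like [U]. *)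
pose H := 1%:M - (P + P).
have Hh : adj H = H by rewrite adjmxB adjmxD adjmx1 Ph.
have HH : H *m H = 1%:M.
  rewrite mulmxBl mul1mx mulmxBr mulmx1 mulmxDl !mulmxDr PP.
  by set Q := P + P; rewrite opprB addrK subrK.
have Hfix x : adj v *m x = 0 -> H *m x = x.
  by move=> vx; rewrite mulmxBl mul1mx mulmxDl -scalemxAl -mulmxA vx mulmx0
    scaler0 addr0 subr0.
have Kraus : kraus [:: U *m H].
  by rewrite /kraus big_seq1 adjmxM Hh -mulmxA (mulmxA (adj U)) UU' mul1mx.
have /(reliable _ Kraus) KU : passes_all prot [:: U *m H].
  move=> it itp t tit; have [a1 b1 [[tP _] _]] := protP _ itp.
  have [_ _ _ passU] := tP _ tit.
  set psi := in_state it in passU *.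
  have Hpsi : H *m psi = psi by apply: Hfix; exact: v_in.
  have psiH : adj psi *m H = adj psi by rewrite -{1}Hh -adjmxM Hpsi.
  rewrite /apply_channel big_seq1 adjmxM Hh !mulmxA -(mulmxA _ H psi) Hpsi.
  rewrite -(mulmxA (pass_op t)) passU -(mulmxA _ (adj psi) H) psiH
    -(mulmxA _ (adj psi) (adj U)) -adjmxM.
  rewrite mxtrace_mulC adjmxM mulmxA -(mulmxA _ (adj U) U) UU' mulmx1.
  by rewrite unit_vec_tens // mxtrace1.
have := KU (v *m adj w); rewrite /apply_channel big_seq1 adjmxM Hh.
have Hv : H *m v = - v.
  by rewrite mulmxBl mul1mx mulmxDl line_proj_id opprD addrA subrr sub0r.
have wH : adj w *m H = adj w by rewrite -{1}Hh -adjmxM Hfix.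
rewrite !mulmxA -(mulmxA U) Hv -(mulmxA _ (adj w)) wH => KUvw.
(* Undoing [U] leaves a vector equal to its own negative. *)
have {KUvw}: v *m adj w *m w = 0.
  have := congr1 (fun A => adj U *m A *m U *m w) KUvw.
  rewrite !mulmxA UU' mul1mx -!(mulmxA _ (adj U)) UU' !mulmx1.
  rewrite mul1mx !mulNmx => vw2.
  apply/eqP; have := scaler_nat 2 (v *m adj w *m w).
  rewrite [RHS]mulr2n -{2}vw2 addNr => /eqP.
  by rewrite scaler_eq0 pnatr_eq0.
rewrite -mulmxA [adj w *m w]mx11_scalar -trace_mx11 mul_mx_scalar => /eqP.
rewrite scaler_eq0 (negPf v0) orbF => /eqP /mxtrace_adj_mul_eq0 /eqP.
by rewrite (negPf w0).
Qed.

(** * The upper bound *)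

(** Each column of [A] is its value on a product of standard basis vectors, which expands bilinearly
    in the products [a i *t b j]. *)
Lemma in_state_spanning (a : 'I_dA -> 'cV[C]_dA) (b : 'I_dB -> 'cV[C]_dB)
    (M : 'M[C]_dA) (N : 'M[C]_dB) (A : 'M[C]_(dA * dB)) :
  (forall k, delta_mx k 0 = \sum_i M k i *: a i) ->
  (forall l, delta_mx l 0 = \sum_j N l j *: b j) ->
  (forall i j, A *m (a i *t b j : 'cV_(dA * dB)) = 0) -> A = 0.
Proof.
move=> aM bN Aab; apply/matrixP => r s; case: (mxtens_indexP s) => k l.
pose X : 'cV_(dA * dB) :=
  (delta_mx k 0 : 'cV[C]_dA) *t (delta_mx l 0 : 'cV[C]_dB).
have -> : A r (mxtens_index (k, l)) = (A *m X) r 0.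
  rewrite mxE (bigD1 (mxtens_index (k, l))) //= big1 => [|q].
    by rewrite !mxE mxtens_indexK !eqxx mulr1 mulr1 addr0.
  case: (mxtens_indexP q) => i j ne; rewrite !mxE mxtens_indexK /=.
  move: ne; rewrite (can_eq (@mxtens_indexK _ _)) xpair_eqE negb_and.
  by case/orP => /negPf ->; rewrite /= ?mul0r ?mulr0.
have -> : X = \sum_i \sum_j (M k i * N l j) *: (a i *t b j : 'cV_(dA * dB)).
  apply/matrixP => p q; rewrite mxE aM bN !summxE mulr_suml.
  apply: eq_bigr => i _; rewrite mulr_sumr summxE; apply: eq_bigr => j _.
  by rewrite !mxE !ord1 mulrACA.
rewrite mulmx_sumr big1 ?mxE // => i _; rewrite mulmx_sumr big1 // => j _.
by rewrite -scalemxAr Aab scaler0.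
Qed.

Lemma settings_upper_bound (U : 'M[C]_(dA * dB)) : (0 < dA)%N -> (0 < dB)%N ->
  (1 < dA * dB)%N -> unitary U ->
  exists2 k, verifiable_with U k & (k <= 2 * (dA * dB))%N.
Proof.
move=> dA0 dB0 d_gt1 Uu; have [_ UU'] := Uu.
have [a [a1 a_nz [M aM]]] := connected_unit_basis _ dA0.
have [b [b1 b_nz [N bN]]] := connected_unit_basis _ dB0.
pose psi (p : 'I_dA * 'I_dB) : 'cV[C]_(dA * dB) := a p.1 *t b p.2.
have [ts tsP] :=
  fin_all_exists (fun p => state_verifiable _ _ (U *m psi p) d_gt1).
pose item p := GateItem (a p.1) (b p.2) (ts p).
pose prot := [seq item p | p <- enum {: 'I_dA * 'I_dB}].
have item_in p : seq_In (item p) prot.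
  by apply/seq_In_map; exists p => //; apply/seq_In_mem; rewrite mem_enum.
have in_item it : seq_In it prot -> exists p, it = item p.
  by case/seq_In_map => p _ ->; exists p.
exists (num_settings prot); last first.
  (* Two tests for each of the [dA * dB] inputs; coinciding settings count once, hence only an
     inequality. *)
  apply: leq_trans (size_undup _) _; rewrite (size_settings 2).
    by rewrite size_map -cardE card_prod !card_ord mulnC.
  by move=> it /in_item[p ->]; case: (tsP p).
exists prot; split=> //; split.
  move=> it /in_item[p ->]; have [tsv _ _ _] := tsP p.
  by split; [exact: a1 | exact: b1 | exact: tsv].
move=> Ks KsP pass; apply: (channel_determined _ _ _ _ psi) => //.
- exact: (Ordinal dA0, Ordinal dB0).
- by move=> p; exact: unit_vec_tens.
- move=> p q; apply/eqP => pq0.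
  (* The overlap of product inputs is the product of the local overlaps, both nonzero. *)
  have := tensmx_mul (adj (a p.1)) (adj (b p.2)) (a q.1) (b q.2).
  rewrite -adjmx_tens => E; have := etrans (esym E) pq0.
  move=> /matrixP/(_ 0 0)/eqP; rewrite !mxE !ord1 mulf_eq0.
  have nz (x : 'M[C]_1) : x != 0 -> x 0 0 != 0.
    by apply: contra_neq => x0; rewrite [x]mx11_scalar x0 raddf0.
  have := nz _ (a_nz p.1 q.1); have := nz _ (b_nz p.2 q.2).
  by rewrite !mxE => /negPf-> /negPf->.
- move=> A A0; apply: (in_state_spanning _ _ _ _ _ aM bN) => i j.
  exact: (A0 (i, j)).
move=> K KKs p; have [_ _ tp fix_ts] := tsP p.
apply: fix_ts => t tt; apply: (passed_output _ _ _ (psi p) _ KsP) => //.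
  exact: tp.
  exact: unit_vec_tens.
exact: pass (item_in p) _ tt.
Qed.

End Bipartite.

End Verification.

(* mu(U) = min { k | verifiable_with U k };  d <= mu(U) <= 2d  with d = dA*dB *)
Theorem theorem3 (R : realType) (dA dB : nat) (hA : (1 < dA)%N) (hB : (1 < dB)%N)
  (U : 'M[R[i]]_(dA * dB)) (hU : unitary U) :
  (forall k, verifiable_with U k -> (dA * dB <= k)%N) /\
  (exists2 k, verifiable_with U k & (k <= 2 * (dA * dB))%N).
Proof.
have d_gt1 : (1 < dA * dB)%N by rewrite (leq_trans hA) // leq_pmulr // ltnW.
split=> [k|]; first exact: settings_lower_bound.
by apply: settings_upper_bound => //; exact: ltnW.
Qed.
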